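(* Let $k>2$ and $\ell\geq 1$ be fixed integers. If $n > 2(k+\ell+2)\binom{6(k+\ell)}{\ell}$ and $G$ is an $n$-vertex $k$-chromatic $\ell$-connected graph, then \[ i(G) \leq i(G^* )=\begin{cases} 2^{n-\ell}+k2^{\ell-k+1}-1, & k\leq \ell,\\ (k-\ell+1)2^{n-k}+\ell, & k>\ell, \end{cases} \] with equality $i(G)=i(G^* )$ if and only if $G=G^*$ (up to isomorphism). Here $G^*=(K_{k-1}\cup E_{\ell-k+1})\vee E_{n-\ell}$ if $k\leq \ell$, and $G^*=K_\ell\vee(K_{k-\ell}\cup E_{n-k})$ if $k>\ell$.
   Context: All graphs are finite and simple. An independent set of $G$ is a set of vertices no two of which are adjacent (the empty set is included); $i(G)$ denotes the number of independent sets of $G$. A graph is $k$-chromatic if its chromatic number is exactly $k$. A graph $G$ is $\ell$-connected if $|V(G)|>\ell$ and any graph obtained by deleting fewer than $\ell$ vertices is connected. $K_m$ and $E_m$ denote the complete and the empty (edgeless) graph on $m$ vertices, $\cup$ denotes disjoint union, and $G_1\vee G_2$ denotes the join: the graph with vertex set $V(G_1)\sqcup V(G_2)$ and edge set $E(G_1)\cup E(G_2)\cup\{xy: x\in V(G_1), y\in V(G_2)\}$. *)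

(* Defs.v *)
From mathcomp Require Import all_boot.

Set Implicit Arguments.
Unset Strict Implicit.
Unset Printing Implicit Defensive.

Record sgraph := SGraph {
  vertex :> finType;
  adj : rel vertex;
  adj_sym : symmetric adj;
  adj_irr : irreflexive adj
}.

Definition iso (G H : sgraph) : Prop :=
  exists2 f : G -> H, bijective f & forall x y, adj (f x) (f y) = adj x y.

Definition independent (G : sgraph) (S : {set G}) : bool :=
  [forall x in S, forall y in S, ~~ adj x y].

Definition num_indep (G : sgraph) : nat := #|[set S : {set G} | independent S]|.

Definition colorable (G : sgraph) (m : nat) : bool :=
  [exists c : {ffun G -> 'I_m}, forall x, forall y, adj x y ==> (c x != c y)].

Lemma colorable_card (G : sgraph) : exists m, colorable G m.
Proof.
exists #|G|; apply/existsP; exists [ffun x => enum_rank x].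
apply/forallP=> x; apply/forallP=> y; apply/implyP=> xy; rewrite !ffunE.
by apply: contraTneq xy => /enum_rank_inj ->; rewrite adj_irr.
Qed.

Definition chromatic_number (G : sgraph) : nat := ex_minn (colorable_card G).

Section DeleteVertices.
Variables (G : sgraph) (S : {set G}).

Definition del_adj : rel {x : G | x \notin S} := fun x y => adj (val x) (val y).

Lemma del_adj_sym : symmetric del_adj.
Proof. by move=> x y; apply: adj_sym. Qed.

Lemma del_adj_irr : irreflexive del_adj.
Proof. by move=> x; apply: adj_irr. Qed.

Definition del_vertices : sgraph := SGraph del_adj_sym del_adj_irr.

End DeleteVertices.

Definition connected (G : sgraph) : bool :=
  (0 < #|G|) && [forall x : G, forall y : G, connect (@adj G) x y].

Definition vertex_connected (l : nat) (G : sgraph) : Prop :=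
  l < #|G| /\ forall S : {set G}, #|S| < l -> connected (del_vertices S).

Section CompleteEmpty.
Variable m : nat.

Definition complete_adj : rel 'I_m := fun x y => x != y.

Lemma complete_adj_sym : symmetric complete_adj.
Proof. by move=> x y; rewrite /complete_adj eq_sym. Qed.

Lemma complete_adj_irr : irreflexive complete_adj.
Proof. by move=> x; rewrite /complete_adj eqxx. Qed.

Definition complete_graph : sgraph := SGraph complete_adj_sym complete_adj_irr.

Definition empty_adj : rel 'I_m := fun _ _ => false.

Lemma empty_adj_sym : symmetric empty_adj.
Proof. by []. Qed.

Lemma empty_adj_irr : irreflexive empty_adj.
Proof. by []. Qed.

Definition empty_graph : sgraph := SGraph empty_adj_sym empty_adj_irr.

End CompleteEmpty.

Section UnionJoin.
Variables G H : sgraph.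

(* [b] is the adjacency between the two sides. *)
Definition sum_adj (b : bool) : rel (G + H)%type := fun u v =>
  match u, v with
  | inl x, inl y => adj x y
  | inr x, inr y => adj x y
  | _, _ => b
  end.

Lemma sum_adj_sym b : symmetric (sum_adj b).
Proof. by move=> [x|x] [y|y] //=; apply: adj_sym. Qed.

Lemma sum_adj_irr b : irreflexive (sum_adj b).
Proof. by move=> [x|x] /=; apply: adj_irr. Qed.

Definition disjoint_union : sgraph :=
  SGraph (sum_adj_sym false) (sum_adj_irr false).

Definition join : sgraph := SGraph (sum_adj_sym true) (sum_adj_irr true).

End UnionJoin.

Definition extremal_graph (k l n : nat) : sgraph :=
  if k <= l then
    join (disjoint_union (complete_graph (k - 1)) (empty_graph (l - k + 1)))
         (empty_graph (n - l))
  else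
    join (complete_graph l)
         (disjoint_union (complete_graph (k - l)) (empty_graph (n - k))).

(* Main.v *)
Require Import Defs.
From mathcomp Require Import all_boot.
From mathcomp Require Import zify.

(** Why the theorem holds.

Since [num_indep (extremal_graph k l n)] is at least [2 ^ (n - (k + l))], a graph
[G] that competes with it has at least the proportion [1 / 2 ^ (k + l)] of all
vertex sets independent.  Each edge of a matching costs a factor 3/4 of that
proportion, so a maximal matching of [G] has fewer than [3 * (k + l)]
edges ([nindep_cover]), and its endpoints form a set [U] of fewer than
[6 * (k + l)] vertices with independent complement.  Connectivity gives every
vertex at least [l] neighbours ([nbr_ge_connectivity]); for the many vertices
outside [U] these all lie in [U], so by the pigeonhole principle some [l]-set [L]
is joined to a large set [W] ([common_neighbours]).  This is where the lower bound
on [n] enters.  An independent set that meets [L] avoids [W]; these are so few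
that [num_indep G] is determined, up to an error [2 ^ (n - #|W|)], by the
independent sets of [G - L] ([nindep_joined_pair]).

The other ingredient is a stable form of the extremal problem without
connectivity ([nindep_chromatic]): among graphs on [N] vertices that are not
[j]-colourable, a clique on [j + 1] vertices plus isolated vertices maximises the
number of independent sets, with the value [(j + 2) * 2 ^ (N - j - 1)], and every
other graph falls short by at least [2 ^ (N - j - 2)].

If [k <= l], a single edge in [G - L] would cost a quarter of [2 ^ (n - l)], much
more than the error term; hence [G - L] is edgeless, each of its vertices has
neighbourhood exactly [L], and [G] is the join of [G[L]] with an edgeless graph.
What remains is to maximise over [G[L]], which is not [(k - 2)]-colourable, and
[nindep_chromatic] identifies the optimum.  If [k > l], the graph [G - L] is not
[(k - l - 1)]-colourable, and the gap in [nindep_chromatic] beats the error term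
unless [G - L] is a clique [K] on [k - l] vertices plus isolated vertices.  The
isolated ones are then joined to all of [L], and the chromatic number forces
[L :|: K] to be a clique, which is the extremal graph. *)

Set Implicit Arguments.
Unset Strict Implicit.
Unset Printing Implicit Defensive.

(** * Counting independent sets inside a vertex set *)

Section CountingIndependentSets.
Variable G : sgraph.
Implicit Types (A B K S : {set G}) (u v x y : G).

Definition nbr v : {set G} := [set x | adj v x].
Definition indep_in A : {set {set G}} := [set S in powerset A | independent S].
Definition nindep A : nat := #|indep_in A|.

Lemma in_indep A S : (S \in indep_in A) = (S \subset A) && independent S.
Proof. by rewrite !inE. Qed.

Lemma independentP S :
  reflect {in S &, forall x y, ~~ adj x y} (independent S).
Proof.
apply: (iffP 'forall_in_'forall_in_idP) => H x; first by move=> y xS; apply: H.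
by move=> xS y yS; apply: H.
Qed.

Lemma independentS S A : S \subset A -> independent A -> independent S.
Proof.
move=> /subsetP sSA /independentP iA; apply/independentP => x y xS yS.
by apply: iA; apply: sSA.
Qed.

Lemma nindep_setT : nindep setT = num_indep G.
Proof. by apply: eq_card => S; rewrite !inE subsetT. Qed.

Lemma nindepS A B : A \subset B -> nindep A <= nindep B.
Proof.
move=> sAB; apply/subset_leq_card/subsetP => S; rewrite !in_indep.
by case/andP=> sSA ->; rewrite (subset_trans sSA sAB).
Qed.

Lemma nindep_le A : nindep A <= 2 ^ #|A|.
Proof.
rewrite -card_powerset; apply/subset_leq_card/subsetP => S.
by rewrite in_indep powersetE => /andP[].
Qed.

Lemma nindep_independent A : independent A -> nindep A = 2 ^ #|A|.
Proof.
move=> iA; rewrite -card_powerset; apply: eq_card => S.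
rewrite in_indep powersetE; apply/andb_idr => sSA; exact: independentS iA.
Qed.

Lemma nindep0 : nindep set0 = 1.
Proof.
rewrite nindep_independent ?cards0 //.
by apply/independentP => x y; rewrite inE.
Qed.

(** The standard recursion: an independent set either avoids [v], or consists of
    [v] and an independent set avoiding [v] and its neighbours. *)
Lemma nindep_rec A v : v \in A ->
  nindep A = nindep (A :\ v) + nindep (A :\ v :\: nbr v).
Proof.
move=> vA; rewrite /nindep.
have -> : indep_in A = indep_in (A :\ v)
    :|: [set v |: S | S in indep_in (A :\ v :\: nbr v)].
  apply/setP => S; rewrite in_setU !in_indep subsetD1.
  have [vS|vS] /= := boolP (v \in S); last first.
    rewrite andbT; apply/idP/orP => [->|[->|/imsetP[T _ eS]] //]; first by left.
    by rewrite eS setU11 in vS.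
  rewrite andbF /=; apply/andP/imsetP => [[sSA /independentP iS]|[T]].
    exists (S :\ v); last by rewrite setD1K.
    rewrite in_indep; apply/andP; split.
      apply/subsetP=> x; rewrite !inE => /andP[xv xS].
      by rewrite xv (subsetP sSA) ?iS.
    by apply/independentP=> x y; rewrite !inE => /andP[_ ?] /andP[_ ?]; apply: iS.
  rewrite in_indep => /andP[/subsetP sT /independentP iT] ->; split.
    apply/subsetP=> x; rewrite !inE => /orP[/eqP->//|/sT].
    by rewrite !inE => /and3P[].
  apply/independentP=> x y; rewrite !inE.
  case/orP=> [/eqP->|xT]; case/orP=> [/eqP->|yT]; last exact: iT.
  - by rewrite adj_irr.
  - by have := sT _ yT; rewrite !inE => /andP[].
  - by have := sT _ xT; rewrite !inE adj_sym => /andP[].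
rewrite cardsU disjoint_setI0 ?cards0 ?subn0.
  congr (_ + _); apply: card_in_imset => S T.
  have vN U : U \in indep_in (A :\ v :\: nbr v) -> v \notin U.
    rewrite in_indep => /andP[/subsetP sU _]; apply/negP => /sU.
    by rewrite !inE eqxx andbF.
  by move=> /vN vS /vN vT eST; rewrite -(setU1K vS) eST setU1K.
rewrite disjoint_subset; apply/subsetP => S; rewrite in_indep => /andP[sS _].
rewrite inE; apply/imsetP => -[T _ eS].
by have := subsetP sS v; rewrite eS setU11 !inE eqxx => /(_ isT).
Qed.

(** An independent set meets [{x, y}] in [set0], [[set x]] or [[set y]]. *)
Lemma nindep_edge A x y : x \in A -> y \in A -> adj x y ->
  nindep A <= 3 * nindep (A :\ x :\ y).
Proof.
move=> xA yA xy.
have yAx : y \in A :\ x.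
  by rewrite !inE yA andbT; apply: contraTneq xy => ->; rewrite adj_irr.
rewrite (nindep_rec xA) (nindep_rec yAx).
have h1 : nindep (A :\ x :\ y :\: nbr y) <= nindep (A :\ x :\ y).
  exact/nindepS/subsetDl.
have h2 : nindep (A :\ x :\: nbr x) <= nindep (A :\ x :\ y).
  by apply/nindepS/setDS; rewrite sub1set inE.
lia.
Qed.

Lemma nindep_not_independent A : ~~ independent A ->
  4 * nindep A <= 3 * 2 ^ #|A|.
Proof.
case/forall_inPn=> x xA /forall_inPn[y yA]; rewrite negbK => xy.
have yAx : y \in A :\ x.
  by rewrite !inE yA andbT; apply: contraTneq xy => ->; rewrite adj_irr.
have := nindep_edge xA yA xy; have := nindep_le (A :\ x :\ y).
rewrite (cardsD1 x A) (cardsD1 y (A :\ x)) xA yAx !add1n !expnS; lia.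
Qed.

Lemma nindep_disconnected A B : [disjoint A & B] ->
  {in A & B, forall x y, ~~ adj x y} -> nindep (A :|: B) = nindep A * nindep B.
Proof.
have [m] := ubnP #|A|; elim: m A => // m IH A ltAm dAB nAB.
have [->|[v vA]] := set_0Vmem A; first by rewrite set0U nindep0 mul1n.
have vB : v \notin B by rewrite (disjointFr dAB vA).
rewrite (nindep_rec vA) mulnDl (@nindep_rec _ v) ?inE ?vA //.
have lt1 : #|A :\ v| < m by move: ltAm; rewrite (cardsD1 v) vA; lia.
have e1 : (A :|: B) :\ v = A :\ v :|: B.
  apply/setP=> x; rewrite !inE; case: eqVneq => [->|//] /=.
  by rewrite (negPf vB).
have e2 : (A :|: B) :\ v :\: nbr v = (A :\ v :\: nbr v) :|: B.
  rewrite e1; apply/setP=> x; rewrite !inE.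
  have [xB|] := boolP (x \in B); last by rewrite !orbF.
  by rewrite !orbT andbT; apply: nAB.
have H (C : {set G}) : C \subset A :\ v -> nindep (C :|: B) = nindep C * nindep B.
  move=> sC; have sCA := subset_trans sC (subD1set A v).
  apply: IH; first exact: leq_ltn_trans (subset_leq_card sC) lt1.
    exact: disjointWl sCA dAB.
  by move=> x y xC yB; apply: nAB => //; apply: (subsetP sCA).
by rewrite e2 e1 !H ?subsetDl.
Qed.

(** An independent set lies in one of two joined sides; only [set0] is counted
    on both, whence the [+ 1]. *)
Lemma nindep_joined A B : {in A & B, forall x y, adj x y} ->
  nindep (A :|: B) + 1 = nindep A + nindep B.
Proof.
move=> jAB; rewrite /nindep.
have -> : indep_in (A :|: B) = indep_in A :|: indep_in B.
  apply/setP=> S; rewrite in_setU !in_indep -andb_orl.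
  apply/andP/andP=> -[sS iS]; split=> //; last first.
    by case/orP: sS => sS; apply: (subset_trans sS); rewrite ?subsetUl ?subsetUr.
  apply/orP; have [sSA|/subsetPn[x xS xA]] := boolP (S \subset A); first by left.
  right.
  have xB : x \in B by have := subsetP sS x xS; rewrite inE (negPf xA).
  apply/subsetP=> y yS; have := subsetP sS y yS; rewrite inE => /orP[yA|//].
  by have := independentP _ iS y x yS xS; rewrite jAB.
have e : indep_in A :&: indep_in B = [set set0].
  apply/setP=> S; rewrite in_setI !in_indep inE; apply/idP/eqP => [|->]; last first.
    by rewrite !sub0set /=; have -> : independent (set0 : {set G})
      by apply/independentP=> x y; rewrite inE.
  case/andP=> /andP[sA _] /andP[sB _]; have [//|[x xS]] := set_0Vmem S.
  have := jAB x x (subsetP sA _ xS) (subsetP sB _ xS).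
  by rewrite adj_irr.
have := cardsUI (indep_in A) (indep_in B); by rewrite e cards1.
Qed.

Lemma nindep_clique K : {in K &, forall x y, x != y -> adj x y} ->
  nindep K = #|K|.+1.
Proof.
have [m] := ubnP #|K|; elim: m K => // m IH K ltK cK.
have [->|[v vK]] := set_0Vmem K; first by rewrite nindep0 cards0.
rewrite (nindep_rec vK) (cardsD1 v K) vK add1n.
have -> : K :\ v :\: nbr v = set0.
  apply/setP=> x; rewrite !inE; apply/negP => /and3P[nvx xv xK].
  by rewrite cK // eq_sym in nvx.
rewrite nindep0 addn1 IH //; first by move: ltK; rewrite (cardsD1 v K) vK; lia.
by move=> x y; rewrite !inE => /andP[_ ?] /andP[_ ?]; apply: cK.
Qed.

End CountingIndependentSets.

(** * Colourings of a vertex set *)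

Section Colourings.
Variable G : sgraph.
Implicit Types (A B K : {set G}) (u v x y : G).

(** The codomain has the spare value [m] so that vertices outside [A] can be
    coloured even when [m = 0]. *)
Definition colors A m : bool := [exists c : {ffun G -> 'I_m.+1},
  [forall x in A, c x < m] &&
  [forall x in A, forall y in A, adj x y ==> (c x != c y)]].

Lemma colorsP A m : reflect
  (exists2 c : G -> nat, {in A, forall x, c x < m} &
     {in A &, forall x y, adj x y -> c x <> c y}) (colors A m).
Proof.
apply: (iffP existsP) => [[c /andP[/forall_inP cm /forall_inP cA]]|[c cm cA]].
  exists (fun x => nat_of_ord (c x)) => // x y xA yA xy.
  by have /forall_inP/(_ y yA)/implyP/(_ xy)/eqP cxy := cA x xA; move/val_inj.
exists [ffun x => inord (c x)]; apply/andP; split.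
  by apply/forall_inP=> x xA; rewrite ffunE inordK ?cm // ltnW // ltnS cm.
apply/forall_inP=> x xA; apply/forall_inP=> y yA; apply/implyP=> xy.
rewrite !ffunE -val_eqE /= !inordK ?ltnS ?(ltnW (cm _ _)) //.
exact/eqP/cA.
Qed.

Lemma colors_setT m : colors setT m -> colorable G m.
Proof.
case/colorsP=> c cm cA; apply/existsP.
exists [ffun x => Ordinal (cm x (in_setT x))].
apply/forallP=> x; apply/forallP=> y; apply/implyP=> xy; rewrite !ffunE -val_eqE.
exact/eqP/cA.
Qed.

Lemma colors_image (T : finType) (D : {set T}) (c : G -> T) A :
  {in A, forall x, c x \in D} -> {in A &, forall x y, adj x y -> c x <> c y} ->
  colors A #|D|.
Proof.
move=> cD cA; apply/colorsP; exists (fun x => index (c x) (enum D)).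
  by move=> x xA; rewrite cardE index_mem mem_enum cD.
move=> x y xA yA xy exy; apply: (cA x y) => //.
by rewrite -(nth_index (c x) (s := enum D) (x := c x)) ?exy ?nth_index ?mem_enum ?cD.
Qed.

(** Each vertex of [B] receives a fresh colour of its own. *)
Lemma colorsD A B m : colors (A :\: B) m -> colors A (m + #|B|).
Proof.
case/colorsP=> c cm cA; apply/colorsP.
exists (fun x => if x \in B then m + index x (enum B) else c x) => [x xA|x y xA yA xy].
  case: ifPn => xB; first by rewrite ltn_add2l cardE index_mem mem_enum.
  by apply: ltn_addr; apply: cm; rewrite !inE xB.
have cm' z : z \in A -> z \notin B -> c z < m by move=> zA zB; apply: cm; rewrite inE zB.
case: ifPn => xB; case: ifPn => yB; last by apply: cA; rewrite ?inE ?xB ?yB.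
- move/addnI=> exy; suff eq_xy : x = y by rewrite eq_xy adj_irr in xy.
  by rewrite -(nth_index x (s := enum B) (x := x)) ?exy ?nth_index ?mem_enum.
- by have := cm' _ yA yB; lia.
- by have := cm' _ xA xB; lia.
Qed.

(** One fresh colour serves all of [B]. *)
Lemma colors_indep A B m : independent B -> colors (A :\: B) m -> colors A m.+1.
Proof.
move=> /independentP iB /colorsP[c cm cA]; apply/colorsP.
exists (fun x => if x \in B then m else c x) => [x xA|x y xA yA xy].
  by case: ifPn => // xB; rewrite ltnW // ltnS cm // inE xB.
have cm' z : z \in A -> z \notin B -> c z < m by move=> zA zB; apply: cm; rewrite inE zB.
case: ifPn => xB; case: ifPn => yB; last by apply: cA; rewrite ?inE ?xB ?yB.
- by rewrite (negPf (iB _ _ xB yB)) in xy.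
- by have := cm' _ yA yB; lia.
- by have := cm' _ xA xB; lia.
Qed.

(** Greedy extension: the neighbours of [v] leave one of the [m] colours free. *)
Lemma colors_low_degree A v m :
  #|A :&: nbr v| < m -> colors (A :\ v) m -> colors A m.
Proof.
case: m => // m ltm /colorsP[c cm cA].
have [i iN] : exists i : 'I_m.+1, i \notin [set inord (c x) | x in A :&: nbr v].
  apply/existsP; apply: contraLR ltm; rewrite negb_exists -leqNgt => /forallP H.
  rewrite -{1}(card_ord m.+1) -cardsT.
  apply: leq_trans (leq_imset_card (fun x => inord (c x) : 'I_m.+1) _).
  by apply/subset_leq_card/subsetP => i _; have := H i; rewrite negbK.
have iN' y : y \in A -> y != v -> adj v y -> c y <> i.
  move=> yA yv vy ey; case/imsetP: iN; exists y; first by rewrite !inE yA.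
  by apply: val_inj; rewrite /= inordK ?cm // !inE yv.
apply/colorsP; exists (fun x => if x == v then val i else c x) => [x xA|x y xA yA].
  by case: eqVneq => [_|xv]; [exact: ltn_ord | apply: cm; rewrite !inE xv].
case: eqVneq => [->|xv]; case: eqVneq => [->|yv] xy.
- by rewrite adj_irr in xy.
- by move/esym; apply: iN'.
- by apply: iN' => //; rewrite adj_sym.
- by apply: cA; rewrite ?inE ?xv ?yv.
Qed.

End Colourings.

(** * Independent sets in graphs of large chromatic number *)

Section Chromatic.
Variable G : sgraph.
Implicit Types (A K : {set G}) (u v x y : G).

Definition clique_plus_isolated A K : Prop :=
  [/\ K \subset A, {in K &, forall x y, x != y -> adj x y}
    & {in A &, forall x y, adj x y -> x \in K}].

Lemma clique_plus_isolated_indep A K :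
  clique_plus_isolated A K -> independent (A :\: K).
Proof.
case=> _ _ eK; apply/independentP=> x y; rewrite !inE.
move=> /andP[xK xA] /andP[_ yA]; exact: contra (eK x y xA yA) xK.
Qed.

Lemma nindep_clique_plus_isolated A K : clique_plus_isolated A K ->
  nindep A * 2 ^ #|K| = #|K|.+1 * 2 ^ #|A|.
Proof.
move=> cpi; have iAK := clique_plus_isolated_indep cpi; case: cpi => sKA cK eK.
have -> : A = K :|: (A :\: K).
  by apply/setP=> x; rewrite !inE; case: (boolP (x \in K)) => // /(subsetP sKA) ->.
rewrite nindep_disconnected ?(nindep_clique cK) ?(nindep_independent iAK) //.
- have -> : #|K :|: (A :\: K)| = #|K| + #|A :\: K|.
    rewrite cardsU disjoint_setI0 ?cards0 ?subn0 //.
    by rewrite disjoint_sym disjoints_subset subsetDr.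
  by rewrite expnD mulnAC mulnA.
- by rewrite disjoint_sym disjoints_subset subsetDr.
move=> x y xK; rewrite inE => /andP[yK yA]; apply: contra yK; rewrite adj_sym.
by apply: eK => //; apply: (subsetP sKA).
Qed.

(** Induction on [#|A|].  In both cases below the count is split by [nindep_rec] at
    a vertex [v], of degree [d] inside [A].

    Suppose that some [v] can be deleted without [A] becoming [j]-colourable.  If
    [d = 0], the structure, or the gap doubled, is inherited from [A :\ v].  If
    [0 < d], deleting the neighbours as well lowers the number of vertices by [d]
    and the number of required colours by at most [d], so the second summand is
    at most [j.+1 * 2 ^ (#|A| - 1 - j.+1)], less than its share in the extremal
    graph, and the gap appears.

    Otherwise [A] is vertex-critical, so every degree is at least [j].  The bound
    for [A :\ v] with one colour less, plus [2 ^ (#|A| - 1 - d)] for the second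
    summand, gives exactly the extremal value when [d = j].  A degree above [j],
    or a gap in [A :\ v], produces the gap for [A]; otherwise [A :\ v] is a clique
    plus isolated vertices, and criticality leaves no room for the latter.

    The gap is stated multiplicatively, the extremal value corresponding to
    [2 * j + 4] in place of [2 * j + 3]. *)
Theorem nindep_chromatic A j : ~~ colors A j ->
  nindep A * 2 ^ j.+2 <= (2 * j + 3) * 2 ^ #|A| \/
  exists2 K : {set G}, #|K| = j.+1 & clique_plus_isolated A K.
Proof.
have [m] := ubnP #|A|; elim: m A j => // m IH A j ltA nA.
have bound (B : {set G}) i : #|B| < m -> ~~ colors B i ->
    nindep B * 2 ^ i.+1 <= (i + 2) * 2 ^ #|B|.
  move=> ltB /(IH _ _ ltB)[|[K cK /nindep_clique_plus_isolated]].
    by rewrite !expnS; nia.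
  by rewrite cK => ->; rewrite addn2.
have cardD v : v \in A -> #|A :\ v|.+1 = #|A| by move=> vA; rewrite (cardsD1 v A) vA.
have cardN v : #|A :\ v :\: nbr v| + #|A :&: nbr v| = #|A :\ v|.
  rewrite -(cardsID (nbr v) (A :\ v)) addnC; congr (_ + _); apply: eq_card => x.
  rewrite !inE; case: eqVneq => [->|//]; by rewrite adj_irr andbF.
have [[v vA nAv]|crit] :
    (exists2 v, v \in A & ~~ colors (A :\ v) j) \/
    {in A, forall v, colors (A :\ v) j}.
  have [/existsP[v /andP[]]|/existsPn H] := boolP [exists v in A, ~~ colors (A :\ v) j].
    by left; exists v.
  by right=> v vA; have := H v; rewrite vA /= negbK.
- have ltv : #|A :\ v| < m by have := cardD v vA; lia.
  rewrite -(cardD v vA) (nindep_rec vA).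
  have [d0|d_gt0] := posnP #|A :&: nbr v|.
    have -> : A :\ v :\: nbr v = A :\ v.
      apply/setDidPl; rewrite disjoint_sym disjoint_subset.
      apply/subsetP=> x xN; rewrite inE; apply/negP; rewrite inE => /andP[_ xA].
      by move/eqP: d0; rewrite cards_eq0 => /eqP/setP/(_ x); rewrite in_setI xA xN inE.
    case: (IH _ _ ltv nAv) => [b|[K cK [sK clK eK]]].
      by left; rewrite mulnDl (expnS 2 #|_ :\ _|) mulnCA mul2n -addnn leq_add.
    right; exists K => //; split=> //; first exact: subset_trans sK (subD1set _ _).
    have noN x : x \in A -> ~~ adj v x.
      move=> xA; apply/negP=> vx; move/eqP: d0; rewrite cards_eq0 => /eqP/setP/(_ x).
      by rewrite !inE xA vx.
    move=> x y xA yA xy; apply: (eK x y) => //; rewrite !inE ?xA ?yA andbT.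
      by apply: contraTneq xy => ->; apply: noN.
    by apply: contraTneq xy => ->; rewrite adj_sym; apply: noN.
  left; have b1 := bound _ _ ltv nAv.
  suff b2 : nindep (A :\ v :\: nbr v) * 2 ^ j.+1 <= j.+1 * 2 ^ #|A :\ v|.
    by rewrite (expnS 2 j.+1) (expnS 2 #|_ :\ _|); nia.
  rewrite -(cardN v); set B := A :\ v :\: nbr v; set d := #|_ :&: _| in d_gt0 *.
  have [le_dj|lt_jd] := leqP d j.
    have nB : ~~ colors B (j - d).
      apply: contra nAv => cB.
      suff : colors (A :\ v) (j - d + d) by rewrite subnK.
      apply: colorsD.
      suff -> : A :\ v :\: (A :&: nbr v) = B by [].
      by apply/setP=> x; rewrite !inE; case: (x \in A); rewrite ?andbF ?andbT.
    have := bound B _ _ nB; rewrite expnD.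
    have -> : 2 ^ j.+1 = 2 ^ (j - d).+1 * 2 ^ d by rewrite -expnD addSn subnK.
    have : 0 < 2 ^ d by rewrite expn_gt0.
    have : #|B| < m by have := cardN v; rewrite -/B; lia.
    move=> hB hd /(_ hB) hb; rewrite mulnA.
    have -> : j.+1 * (2 ^ #|B| * 2 ^ d) = (j.+1 * 2 ^ #|B|) * 2 ^ d by lia.
    rewrite leq_mul2r; apply/orP; right; apply: leq_trans hb _.
    by rewrite leq_mul2r; apply/orP; right; lia.
  have := nindep_le B; have : 2 ^ j.+1 <= 2 ^ d by rewrite leq_exp2l.
  by rewrite expnD; nia.
have [A0|[v0 v0A]] := set_0Vmem A.
  case/colorsP: nA; exists (fun=> 0) => x; rewrite A0 inE //.
have deg v : v \in A -> j <= #|A :&: nbr v|.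
  move=> vA; rewrite leqNgt; apply: contra nA => lt_d.
  exact: colors_low_degree lt_d (crit v vA).
case: j => [|j] in nA crit deg *.
  right; exists [set v0]; first by rewrite cards1.
  have eA : A = [set v0].
    apply/eqP; rewrite eqEsubset sub1set v0A andbT; apply/subsetP=> x xA.
    rewrite inE; apply: contraT => xv; have /colorsP[c cm _] := crit _ v0A.
    by have := cm x; rewrite !inE xv xA => /(_ isT).
  split; rewrite ?eA // => x y; rewrite !inE.
  by move=> /eqP-> /eqP->; rewrite eqxx.
have nAv v : v \in A -> ~~ colors (A :\ v) j.
  by move=> vA; apply: contra nA => /colorsD; rewrite cards1 addn1.
have ltv v : v \in A -> #|A :\ v| < m by move=> vA; have := cardD v vA; lia.
have nb v : nindep (A :\ v :\: nbr v) * 2 ^ #|A :&: nbr v| <= 2 ^ #|A :\ v|.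
  by rewrite -(cardN v) expnD leq_mul2r nindep_le orbT.
have [/existsP[v /andP[vA dv]]|/existsPn degle] :=
    boolP [exists v in A, j.+1 < #|A :&: nbr v|].
  left; rewrite -(cardD v vA) (nindep_rec vA).
  have b1 := bound _ _ (ltv _ vA) (nAv _ vA); have b2 := nb v.
  have : 2 ^ j.+2 <= 2 ^ #|A :&: nbr v| by rewrite leq_exp2l.
  rewrite !expnS in b1 b2 *; nia.
have degE v : v \in A -> #|A :&: nbr v| = j.+1.
  move=> vA; apply/eqP; rewrite eqn_leq deg // andbT.
  by have := degle v; rewrite vA /= -leqNgt.
have {nb} b2 := nb v0; rewrite degE // in b2.
rewrite -(cardD v0 v0A) (nindep_rec v0A).
case: (IH _ _ (ltv _ v0A) (nAv _ v0A)) => [b1|[K cK [sK clK eK]]].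
  by left; rewrite !expnS in b1 b2 *; nia.
right.
have sKA x : x \in K -> (x != v0) && (x \in A) by move/(subsetP sK); rewrite !inE.
(* A vertex of [K] has only [j] neighbours in [K], so it also sees [v0]; as [v0]
   has degree [#|K|], its neighbourhood is exactly [K]. *)
have KN : K \subset A :&: nbr v0.
  apply/subsetP=> z zK; have /andP[zv zA] := sKA z zK; rewrite !inE zA /=.
  apply: contraT => nzv; have := degE z zA; have := cK.
  rewrite (cardsD1 z K) zK add1n => -[eK1] eK2.
  suff : A :&: nbr z \subset K :\ z by move/subset_leq_card; rewrite eK1 eK2; lia.
  apply/subsetP=> y; rewrite !inE => /andP[yA zy].
  have yv : y != v0 by apply: contraNneq nzv => <-; rewrite adj_sym.
  rewrite (eK y z) ?inE ?yv ?zv ?yA ?zA ?(adj_sym y) ?andbT //.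
  by apply: contraTneq zy => ->; rewrite adj_irr.
have eKN : K = A :&: nbr v0 by apply/eqP; rewrite eqEcard KN (degE v0 v0A) cK /=.
(* A further vertex would have degree 0. *)
have eA : A = v0 |: K.
  apply/setP=> e; rewrite !inE; apply/idP/orP => [eIA|[/eqP->|/sKA/andP[]]//].
  have [|ev] := eqVneq e v0; first by left.
  right; apply: contraT => eNK.
  have : #|A :&: nbr e| = 0.
    apply/eqP; rewrite cards_eq0 -subset0; apply/subsetP=> y; rewrite !inE.
    case/andP=> yA ey; have [yv|yv] := eqVneq y v0.
      by rewrite yv in ey; rewrite eKN !inE eIA adj_sym ey in eNK.
    by case/negP: eNK; apply: (eK e y); rewrite ?inE ?ev ?yv.
  by rewrite degE.
have v0K : v0 \notin K by rewrite eKN !inE adj_irr andbF.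
exists A; first by rewrite -(cardD v0 v0A) eA setU1K ?cK.
split=> //; rewrite eA => x y; rewrite !inE.
have Kadj z : z \in K -> adj v0 z by rewrite eKN !inE => /andP[].
case/orP=> [/eqP->|xK]; case/orP=> [/eqP->|yK].
- by rewrite eqxx.
- by rewrite Kadj.
- by rewrite adj_sym Kadj.
- exact: clK.
Qed.

End Chromatic.

(** * A small set joined to a large one *)

Section JoinedPair.
Variable G : sgraph.
Implicit Types (A B S U L W : {set G}) (u v x y : G).

(** Remove the ends of an edge [m] times: each removal costs a factor 3/4 by
    [nindep_edge].  If no edge is left after fewer than [m] removals, the removed
    vertices are the set [U]. *)
Lemma nindep_cover A m :
  nindep A * 4 ^ m <= 3 ^ m * 2 ^ #|A| \/
  exists2 U : {set G}, #|U| < 2 * m & independent (A :\: U).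
Proof.
elim: m A => [|m IH] A; first by left; rewrite muln1 mul1n nindep_le.
have [iA|] := boolP (independent A).
  by right; exists set0; rewrite ?cards0 // setD0.
case/forall_inPn=> x xA /forall_inPn[y yA]; rewrite negbK => xy.
have yAx : y \in A :\ x.
  by rewrite !inE yA andbT; apply: contraTneq xy => ->; rewrite adj_irr.
have le3 := nindep_edge xA yA xy.
have cA : #|A| = #|A :\ x :\ y|.+2.
  by rewrite (cardsD1 x A) (cardsD1 y (A :\ x)) xA yAx.
case: (IH (A :\ x :\ y)) => [le|[U ltU iU]].
  left; rewrite cA !expnS; move: le le3.
  move: (4 ^ m) (3 ^ m) (2 ^ _) => p q r le le3.
  have := leq_mul le3 (leqnn p); lia.
right; exists (x |: (y |: U)).
  apply: leq_ltn_trans (leq_card_setU _ _) _; rewrite cards1.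
  have [+ _] := leq_card_setU [set y] U; rewrite cards1; lia.
apply: independentS iU; apply/subsetP=> z; rewrite !inE !negb_or.
by case/andP=> /and3P[-> -> ->] ->.
Qed.

(** Deleting the neighbourhood of a vertex isolates it. *)
Lemma nbr_ge_connectivity l : vertex_connected l G -> forall v, l <= #|nbr v|.
Proof.
case=> ltlG conn v; rewrite leqNgt; apply/negP => lt_d.
have vN : v \notin nbr v by rewrite inE adj_irr.
have [w] : exists w, w \notin v |: nbr v.
  apply/existsP; rewrite -negb_forall; apply/negP=> /forallP H.
  have : #|G| <= #|v |: nbr v|.
    by rewrite -cardsT; apply/subset_leq_card/subsetP => x _; apply: H.
  by rewrite cardsU1 vN; lia.
rewrite in_setU1 negb_or => /andP[wv wN].
case/andP: (conn _ lt_d) => _ /forallP/(_ (exist _ v vN))/forallP/(_ (exist _ w wN)).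
case/connectP=> -[|u p] /=; first by move=> _ [ewv]; rewrite ewv eqxx in wv.
case/andP=> vu _ _; have := valP u; rewrite inE.
by rewrite /= in vu; rewrite [adj _ _]vu.
Qed.

Lemma exists_subset_card A m : m <= #|A| -> exists2 S : {set G}, S \subset A & #|S| = m.
Proof.
rewrite -bin_gt0 -cards_draws; case/card_gt0P=> S; rewrite inE => /andP[sS /eqP cS].
by exists S.
Qed.

(** Pigeonhole: the vertices outside [U] have their neighbours in [U], and each of
    them selects an [l]-subset of [U] in its neighbourhood. *)
Lemma common_neighbours U l m :
  independent (~: U) -> (forall v, l <= #|nbr v|) -> 'C(#|U|, l) * m < #|~: U| ->
  exists L W, [/\ #|L| = l, m < #|W| & {in L & W, forall x y, adj x y}].
Proof.
move=> /independentP iU deg ltmU; pose P := [set L : {set G} | L \subset U & #|L| == l].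
pose W L := [set w in ~: U | L \subset nbr w].
have cover : ~: U \subset \bigcup_(L in P) W L.
  apply/subsetP=> w wU; have [L sL cL] := exists_subset_card (deg w).
  apply/bigcupP; exists L; last by rewrite inE wU.
  rewrite inE cL eqxx andbT; apply/subsetP=> x /(subsetP sL); rewrite inE => wx.
  by apply: contraT => xU; rewrite (negPf (iU _ _ wU _)) ?inE // in wx.
have le_sum : #|~: U| <= \sum_(L in P) #|W L|.
  apply: leq_trans (subset_leq_card cover) _.
  elim/big_rec2: _ => [|L B s _ leB]; first by rewrite cards0.
  by apply: leq_trans (leq_card_setU _ _) _; rewrite leq_add2l.
have [/exists_inP[L]|/exists_inPn H] := boolP [exists L in P, m < #|W L|].
  rewrite inE => /andP[_ /eqP cL] ltm; exists L, (W L); split=> // x y xL.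
  by rewrite inE => /andP[_ /subsetP/(_ x xL)]; rewrite inE adj_sym.
move: ltmU; rewrite ltnNge -cards_draws -sum_nat_const => /negP[].
by apply: leq_trans le_sum _; apply: leq_sum => L LP; rewrite leqNgt H.
Qed.

(** An independent set that meets [L] avoids [W]. *)
Lemma nindep_joined_pair L W : {in L & W, forall x y, adj x y} ->
  nindep [set: G] <= nindep (~: L) + 2 ^ (#|G| - #|W|).
Proof.
move=> jLW; have <- : #|~: W| = #|G| - #|W| by rewrite cardsCs setCK.
apply: leq_trans (leq_add (leqnn _) (nindep_le (~: W))).
apply: leq_trans (leq_card_setU _ _).
apply/subset_leq_card/subsetP=> S; rewrite in_setU !in_indep subsetT => /= iS.
rewrite iS !andbT -implyNb; apply/implyP=> /subsetPn[x xS].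
rewrite inE negbK => xL.
apply/subsetP=> w wS; rewrite inE; apply/negP=> wW.
by have := independentP _ iS x w xS wS; rewrite jLW.
Qed.

End JoinedPair.

(** * Recognising induced subgraphs *)

Section Induces.
Variable G : sgraph.
Implicit Types A B : {set G}.

(** Being witnessed by an injection, rather than by a subtype on [A], this can be
    assembled along unions; the case [A = setT] is isomorphism. *)
Definition induces A (H : sgraph) : Prop :=
  exists f : H -> G, [/\ injective f, A = [set f x | x in H]
                       & forall x y, adj (f x) (f y) = adj x y].

Lemma induces_iso H : induces setT H -> iso G H.
Proof.
case=> f [injf /setP onf adjf].
have cf : #|G| <= #|H|.
  rewrite -(card_imset H injf) -cardsT; apply/subset_leq_card/subsetP=> x xT.
  by rewrite -onf.
have [g fg gf] := inj_card_bij injf cf.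
by exists g => [|x y]; [exists f | rewrite -adjf !gf].
Qed.

Lemma nindep_induces A H : induces A H -> nindep A = num_indep H.
Proof.
case=> f [injf eA adjf]; rewrite /num_indep.
have -> : nindep A = #|[set f @: (S : {set H}) | S in [set S | independent S]]|.
  apply: eq_card => T; rewrite in_indep; apply/andP/imsetP => [[sT iT]|[S]].
    exists (f @^-1: T).
      rewrite inE; apply/independentP=> x y; rewrite !inE -adjf => ??.
      exact: independentP iT _ _ _ _.
    apply/setP=> y; apply/idP/imsetP => [yT|[x xT ->]]; last by rewrite inE in xT.
    have := subsetP sT y yT; rewrite eA => /imsetP[x _ eyx].
    by exists x; rewrite // inE -eyx.
  rewrite inE => /independentP iS ->; split; first by rewrite eA imsetS //; apply/subsetP.
  apply/independentP=> _ _ /imsetP[x xS ->] /imsetP[y yS ->]; rewrite adjf.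
  exact: iS.
by apply: card_imset; apply: imset_inj.
Qed.

Lemma induces_complete A m : #|A| = m -> {in A &, forall x y, x != y -> adj x y} ->
  induces A (complete_graph m).
Proof.
move=> <- cA; exists enum_val; split; first exact: enum_val_inj.
  apply/setP=> x; apply/idP/imsetP=> [xA|[i _ ->]]; last exact: enum_valP.
  by exists (enum_rank_in xA x); rewrite // enum_rankK_in.
move=> i j; rewrite /= /complete_adj.
have [->|ij] := eqVneq; first by rewrite adj_irr.
by apply: cA; rewrite ?enum_valP // (inj_eq enum_val_inj).
Qed.

Lemma induces_empty A m : #|A| = m -> independent A -> induces A (empty_graph m).
Proof.
move=> <- /independentP iA; exists enum_val; split; first exact: enum_val_inj.
  apply/setP=> x; apply/idP/imsetP=> [xA|[i _ ->]]; last exact: enum_valP.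
  by exists (enum_rank_in xA x); rewrite // enum_rankK_in.
by move=> i j; apply/negbTE/iA; apply: enum_valP.
Qed.

Lemma induces_sum b A B H1 H2 : [disjoint A & B] ->
  {in A & B, forall x y, adj x y = b} -> induces A H1 -> induces B H2 ->
  induces (A :|: B) (SGraph (@sum_adj_sym H1 H2 b) (@sum_adj_irr H1 H2 b)).
Proof.
move=> dAB adjAB [f [injf eA adjf]] [g [injg eB adjg]].
have fA x : f x \in A by rewrite eA imset_f.
have gB x : g x \in B by rewrite eB imset_f.
have fg x y : f x <> g y by move=> e; have := disjointFr dAB (fA x); rewrite e gB.
exists (fun u : H1 + H2 => match u with inl x => f x | inr y => g y end); split.
- by move=> [x|x] [y|y] // e; [rewrite (injf _ _ e)|case: (fg _ _ e)|
    case: (fg _ _ (esym e))|rewrite (injg _ _ e)].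
- apply/setP=> z; rewrite inE; apply/orP/imsetP => [[]|[[x|x] _ ->]]; last first.
  + by right.
  + by left.
  + by rewrite eB => /imsetP[x _ ->]; exists (inr x).
  by rewrite eA => /imsetP[x _ ->]; exists (inl x).
by move=> [x|x] [y|y] //=; [rewrite adjAB | rewrite adj_sym adjAB].
Qed.

End Induces.

(** * The extremal graph *)

Lemma num_indep_iso G H : iso G H -> num_indep G = num_indep H.
Proof.
case=> f [g fg gf] adjf; rewrite -nindep_setT; apply: nindep_induces.
exists g; split; first exact: can_inj gf.
  by apply/setP=> x; rewrite inE -(fg x) imset_f.
by move=> x y; rewrite -adjf !gf.
Qed.

Lemma num_indep_complete m : num_indep (complete_graph m) = m.+1.
Proof. by rewrite -nindep_setT nindep_clique // cardsT card_ord. Qed.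

Lemma num_indep_empty m : num_indep (empty_graph m) = 2 ^ m.
Proof.
rewrite -nindep_setT nindep_independent ?cardsT ?card_ord //.
exact/independentP.
Qed.

Section NumIndepSum.
Variables (H1 H2 : sgraph) (b : bool).
Let H := SGraph (@sum_adj_sym H1 H2 b) (@sum_adj_irr H1 H2 b).
Let A : {set H} := [set inl x | x in H1].
Let B : {set H} := [set inr x | x in H2].

Let AB : [set: H] = A :|: B.
Proof.
by apply/esym/setP=> -[x|x]; rewrite !inE; apply/orP; [left|right]; apply: imset_f.
Qed.

Let disjAB : [disjoint A & B].
Proof.
rewrite disjoint_subset; apply/subsetP=> _ /imsetP[x _ ->]; rewrite inE.
by apply/imsetP=> -[].
Qed.

Let nA : nindep A = num_indep H1.
Proof. by apply: nindep_induces; exists inl; split=> // x y []. Qed.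

Let nB : nindep B = num_indep H2.
Proof. by apply: nindep_induces; exists inr; split=> // x y []. Qed.

Lemma num_indep_sum : if b then num_indep H + 1 = num_indep H1 + num_indep H2
                      else num_indep H = num_indep H1 * num_indep H2.
Proof.
rewrite -(nindep_setT H) -nA -nB AB; case eb: b.
  by apply: nindep_joined => _ _ /imsetP[x _ ->] /imsetP[y _ ->] /=; rewrite eb.
apply: nindep_disconnected => // _ _ /imsetP[x _ ->] /imsetP[y _ ->] /=.
by rewrite eb.
Qed.
End NumIndepSum.

Lemma num_indep_join H1 H2 :
  num_indep (join H1 H2) + 1 = num_indep H1 + num_indep H2.
Proof. exact: (num_indep_sum H1 H2 true). Qed.

Lemma num_indep_disjoint_union H1 H2 :
  num_indep (disjoint_union H1 H2) = num_indep H1 * num_indep H2.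
Proof. exact: (num_indep_sum H1 H2 false). Qed.

Lemma num_indep_extremal k l n : 0 < k -> num_indep (extremal_graph k l n) =
  if k <= l then 2 ^ (n - l) + k * 2 ^ (l - k + 1) - 1
  else (k - l + 1) * 2 ^ (n - k) + l.
Proof.
move=> k_gt0; rewrite /extremal_graph; case: ifP => _.
  have := num_indep_join (disjoint_union (complete_graph (k - 1))
    (empty_graph (l - k + 1))) (empty_graph (n - l)).
  rewrite num_indep_disjoint_union !num_indep_empty num_indep_complete subn1.
  rewrite prednK //; lia.
have := num_indep_join (complete_graph l)
  (disjoint_union (complete_graph (k - l)) (empty_graph (n - k))).
rewrite num_indep_disjoint_union num_indep_empty !num_indep_complete addn1; lia.
Qed.

(** * Comparison with the extremal graph *)

Lemma ltn_bin p l : 0 < l -> p < 'C(p + l, l).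
Proof.
case: l => // l _; elim: p => [|p IH]; first by rewrite binn.
rewrite addSn binS; have : 0 < 'C(p + l.+1, l) by rewrite bin_gt0; lia.
lia.
Qed.

Section Dichotomy.
Variables (G : sgraph) (k l : nat).
Hypotheses (nc : ~~ colors [set: G] k.-1) (deg : forall v : G, l <= #|nbr v|).
Variables (L W : {set G}).
Hypotheses (cL : #|L| = l) (jLW : {in L & W, forall x y, adj x y}).
Hypothesis (bigW : k + l + 3 <= #|W|).

Let leWG : #|W| <= #|G|. Proof. exact: max_card. Qed.

Let cCL : #|~: L| = #|G| - l. Proof. by rewrite cardsCs setCK cL. Qed.

(** An edge outside [L] costs a quarter of the main term [2 ^ (#|G| - l)].  Without
    such edges [G] is the join of [L] with an edgeless graph, so [nindep L] decides,
    and [L] needs at least [k.-1] colours because one more colour serves [~: L]. *)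
Lemma below_extremal_or_iso_le : 1 < k -> k <= l ->
  num_indep G < 2 ^ (#|G| - l) + k * 2 ^ (l - k + 1) - 1 \/
  iso G (extremal_graph k l #|G|).
Proof.
move=> k_gt1 le_kl; rewrite -nindep_setT.
have [iC|niC] := boolP (independent (~: L)); last first.
  left; have := nindep_joined_pair jLW; have := nindep_not_independent niC.
  have : 0 < k * 2 ^ (l - k + 1) by rewrite muln_gt0 expn_gt0; lia.
  move: (k * _) => q q_gt0; rewrite cCL.
  have -> : #|G| - l = #|G| - #|W| + (#|W| - l - 3) + 3 by lia.
  rewrite !expnD; have : 0 < 2 ^ (#|W| - l - 3) by rewrite expn_gt0.
  have : 0 < 2 ^ (#|G| - #|W|) by rewrite expn_gt0.
  move: (2 ^ (_ - _ - _)) (2 ^ (_ - _)) => p r ? ? ? ?.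
  nia.
have adjL : {in L & ~: L, forall x y, adj x y}.
  move=> x y xL yL; suff eL : L = nbr y by rewrite adj_sym; rewrite eL inE in xL.
  apply/esym/eqP; rewrite eqEcard cL deg andbT; apply/subsetP=> z; rewrite inE => yz.
  apply: contraT => zL; have := independentP _ iC y z yL.
  by rewrite inE zL yz => /(_ isT).
have eT : [set: G] = L :|: ~: L by rewrite setUCr.
have ncL : ~~ colors L k.-2.
  apply: contra nc => cLk; have -> : k.-1 = k.-2.+1 by lia.
  by apply: colors_indep iC _; rewrite setDE setCK setTI.
have := nindep_joined adjL; rewrite -eT (nindep_independent iC) cCL.
case: (nindep_chromatic ncL) => [gap|[K cK cpi]] eN.
  left; suff : nindep L < k * 2 ^ (l - k + 1) by lia.
  rewrite -(@ltn_pmul2r (2 ^ k)) ?expn_gt0 // -mulnA -expnD.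
  have -> : l - k + 1 + k = l.+1 by lia.
  rewrite cL in gap; have e : k.-2.+2 = k by lia.
  rewrite e in gap; apply: leq_ltn_trans gap _.
  rewrite expnS mulnA ltn_pmul2r ?expn_gt0 //.
  lia.
right; rewrite /extremal_graph le_kl; apply: induces_iso; rewrite eT.
have iLK := clique_plus_isolated_indep cpi; case: cpi => sKL clK eK.
apply: induces_sum => //; last exact: induces_empty.
  by rewrite disjoints_subset setCK.
have -> : L = K :|: (L :\: K) by rewrite setDE setUIr setUCr setIT; apply/esym/setUidPr.
apply: induces_sum.
- by rewrite disjoint_sym disjoints_subset subsetDr.
- move=> x y xK; rewrite inE => /andP[yK yL]; apply: contraNF yK => xy.
  by apply: (eK y x); rewrite 1?adj_sym //; apply: (subsetP sKL).
- by apply: induces_complete => //; lia.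
apply: induces_empty => //; rewrite cardsD (setIidPr sKL) cL cK; lia.
Qed.

(** Colouring [L] rainbow shows that [~: L] is not [(k - l).-1]-colourable, so the
    gap of [nindep_chromatic] is [2 ^ (#|G| - k - 1)], which exceeds the
    contribution of the independent sets meeting [L].  Hence [~: L] is a clique [K]
    plus isolated vertices, and the latter are joined to [L] by their degrees. *)
Lemma below_extremal_or_iso_gt : l < k ->
  num_indep G < (k - l + 1) * 2 ^ (#|G| - k) + l \/
  iso G (extremal_graph k l #|G|).
Proof.
move=> lt_lk; rewrite -nindep_setT.
have ncC : ~~ colors (~: L) (k - l).-1.
  apply: contra nc; rewrite -setTD => /colorsD; rewrite cL.
  by have -> : (k - l).-1 + l = k.-1 by lia.
case: (nindep_chromatic ncC) => [gap|[K cK cpi]].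
  left; have := nindep_joined_pair jLW; move: gap; rewrite cCL.
  have -> : (k - l).-1.+2 = (k - l).+1 by lia.
  have -> : #|G| - l = #|G| - k + (k - l) by lia.
  have -> : #|G| - k = #|G| - #|W| + (#|W| - k - 2) + 2 by lia.
  rewrite expnS [2 ^ (_ + (k - l))]expnD mulnA mulnA leq_pmul2r ?expn_gt0 // !expnD.
  have : 0 < 2 ^ (#|W| - k - 2) by rewrite expn_gt0.
  have : 0 < 2 ^ (#|G| - #|W|) by rewrite expn_gt0.
  move: (2 ^ (_ - _ - _)) (2 ^ (_ - _)) => p q ? ?.
  nia.
right; have iC := clique_plus_isolated_indep cpi; case: cpi => sKC clK eK.
have ck : #|K| = k - l by lia.
have KL x : x \in K -> x \notin L by move/(subsetP sKC); rewrite inE.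
have far x y : x \notin L -> x \notin K -> y \notin L -> ~~ adj x y.
  by move=> xL xK yL; apply: contra xK; apply: eK; rewrite inE.
have adjL x y : x \notin L -> nbr x \subset L -> y \in L -> adj x y.
  move=> xL sx yL; suff eL : L = nbr x by move: yL; rewrite eL inE.
  by apply/esym/eqP; rewrite eqEcard sx cL deg.
have adjE x y : x \notin L -> x \notin K -> y \in L -> adj x y.
  move=> xL xK; apply: adjL => //; apply/subsetP=> z; rewrite inE => xz.
  by apply: contraTT xz; apply: far.
(* A missing edge [x y] of [L :|: K] would allow a colouring with [k.-1] colours,
   named by the vertices of [(L :|: K) :\ y]: [y] takes the colour of [x], and
   the isolated part that of some [z] in [K] other than [y].  Such a [z] is lacking
   only if [K = [set y]], and then the degree of [y] joins it to all of [L]. *)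
have clLK x y : x \in L -> y \in L :|: K -> x != y -> adj x y.
  move=> xL yLK xy; apply: contraT => nxy.
  have [z zK zy] : exists2 z, z \in K & z != y.
    have [y1|] := boolP [exists z in K, z != y].
      by case/exists_inP: y1 => z; exists z.
    move/exists_inPn=> H; have eKy z : z \in K -> z = y by move/H; rewrite negbK => /eqP.
    have [z zK] : exists z, z \in K by apply/card_gt0P; lia.
    have yK : y \in K by rewrite -(eKy z zK).
    case/negP: nxy; rewrite adj_sym; apply: adjL; rewrite ?KL //.
    apply/subsetP=> u; rewrite inE => yu; apply: contraT => uL.
    have uK : u \in K by apply: (eK u y); rewrite 1?adj_sym // inE // KL.
    by rewrite (eKy u uK) adj_irr in yu.
  case/negP: nc.
  have cD : #|(L :|: K) :\ y| = k.-1.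
    have : #|L :|: K| = k.
      rewrite cardsU disjoint_setI0 ?cards0 ?subn0 ?cL ?ck; first lia.
      by rewrite disjoint_sym disjoints_subset.
    rewrite (cardsD1 y) yLK; lia.
  rewrite -cD.
  pose c v := if v == y then x else if v \in L :|: K then v else z.
  have zL := KL z zK.
  apply: (@colors_image G _ _ c) => [v _|u v _ _ uv].
    rewrite /c; case: eqVneq => [_|vy]; first by rewrite !inE xy xL.
    case: ifP => vLK; first by rewrite in_setD1 vy vLK.
    by rewrite !inE zy zK orbT.
  have out w : w \in L :|: K = false -> w \notin L /\ w \notin K.
    by rewrite inE; case: (w \in L) (w \in K) => [] [].
  have farz w : w \in L :|: K = false -> ~~ adj w z by case/out=> wL wK; apply: far.
  have xz : x <> z by move=> e; rewrite -e xL in zL.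
  rewrite /c; case: eqVneq uv => [->|uy]; case: eqVneq => [->|vy];
    first by rewrite adj_irr.
  - case: ifP => _ uv // e; by rewrite adj_sym -e (negPf nxy) in uv.
  - case: ifP => _ uv e; [by rewrite e (negPf nxy) in uv | exact: xz].
  case: ifP => uLK; case: ifP => vLK uv e.
  - by rewrite e adj_irr in uv.
  - by rewrite e adj_sym (negPf (farz _ vLK)) in uv.
  - by rewrite -e (negPf (farz _ uLK)) in uv.
  have [uL uK] := out _ uLK; have [vL _] := out _ vLK.
  by rewrite (negPf (far _ _ uL uK vL)) in uv.
rewrite /extremal_graph leqNgt lt_lk /=; apply: induces_iso.
rewrite -(setUCr L); apply: induces_sum.
- by rewrite disjoints_subset setCK.
- move=> x y xL; rewrite inE => yL; have [yK|yK] := boolP (y \in K).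
    by rewrite clLK ?inE ?yK ?orbT //; apply: contraNneq yL => <-.
  by rewrite adj_sym adjE.
- by apply: induces_complete => // x y xL yL; apply: clLK; rewrite ?inE ?yL.
have -> : ~: L = K :|: (~: L :\: K).
  by rewrite setDE setUIr setUCr setIT; apply/esym/setUidPr.
apply: induces_sum.
- by rewrite disjoint_sym disjoints_subset subsetDr.
- move=> x y xK; rewrite !inE => /andP[yK yL]; rewrite adj_sym.
  by apply/negbTE/far => //; apply: KL.
- exact: induces_complete.
apply: induces_empty => //; rewrite cardsD (setIidPr sKC) cCL ck.
by rewrite -subnDA subnKC // ltnW.
Qed.

End Dichotomy.

Theorem theorem1p2 (k l n : nat) (hk : 2 < k) (hl : 1 <= l)
    (hn : 2 * (k + l + 2) * 'C(6 * (k + l), l) < n)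
    (G : sgraph) (hG : #|G| = n)
    (hchi : chromatic_number G = k) (hconn : vertex_connected l G) :
  [/\ num_indep G <= num_indep (extremal_graph k l n),
      num_indep (extremal_graph k l n) =
        (if k <= l then 2 ^ (n - l) + k * 2 ^ (l - k + 1) - 1
         else (k - l + 1) * 2 ^ (n - k) + l)
    & num_indep G = num_indep (extremal_graph k l n) <->
      iso G (extremal_graph k l n)].
Proof.
have eI := @num_indep_extremal k l n (ltnW (ltnW hk)).
suff [lt|iG] : num_indep G < num_indep (extremal_graph k l n) \/
               iso G (extremal_graph k l n).
- split=> //; first exact: ltnW.
  by split=> [e|/num_indep_iso e]; rewrite e ltnn in lt.
- by rewrite (num_indep_iso iG); split.
have nc : ~~ colors [set: G] k.-1.
  apply/negP=> /colors_setT; move: hchi; rewrite /chromatic_number.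
  case: ex_minnP => m _ min_m em /min_m; lia.
have deg := nbr_ge_connectivity hconn.
(* Bounding this binomial below by 6 absorbs the vertices of [U] into half of the
   lower bound on [n]. *)
have bin6 : 6 <= 'C(6 * (k + l), l).
  have := @ltn_bin (6 * k + 5 * l) l hl.
  have -> : 6 * k + 5 * l + l = 6 * (k + l) by lia.
  lia.
have le_n : k + l <= n by nia.
(* Three matching edges per unit of [k + l] suffice, as 2 * 3 ^ 3 < 4 ^ 3. *)
case: (nindep_cover [set: G] (3 * (k + l))) => [small|[U ltU iU]].
  left; rewrite nindep_setT cardsT hG !expnM in small.
  have lt1 : num_indep G < 2 ^ (n - (k + l)).
    rewrite ltnNge; apply/negP=> big.
    have := leq_mul big (leqnn ((4 ^ 3) ^ (k + l))).
    have e2n : 2 ^ n = 2 ^ (n - (k + l)) * 2 ^ (k + l) by rewrite -expnD subnK.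
    move/leq_trans/(_ small); rewrite e2n.
    rewrite mulnCA leq_pmul2l ?expn_gt0 // -expnMn leqNgt ltn_exp2r //; lia.
  apply: leq_trans lt1 _; rewrite eI; case: (leqP k l) => cmp.
    have : 2 ^ (n - (k + l)) <= 2 ^ (n - l) by rewrite leq_exp2l //; lia.
    have : 0 < 2 ^ (l - k + 1) by rewrite expn_gt0.
    nia.
  apply: leq_trans (leq_addr _ _); apply: leq_trans (leq_pmull _ _);
    last by rewrite addn1.
  by rewrite leq_exp2l //; lia.
rewrite setTD in iU.
have [L [W [cL ltW jLW]]] : exists L W : {set G},
    [/\ #|L| = l, k + l + 2 < #|W| & {in L & W, forall x y, adj x y}].
  apply: (common_neighbours iU deg).
  have : 'C(#|U|, l) <= 'C(6 * (k + l), l) by apply: leq_bin2l; lia.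
  have : #|~: U| = n - #|U| by rewrite cardsCs setCK hG.
  move=> ->; nia.
have bigW : k + l + 3 <= #|W| by rewrite addnS.
rewrite eI -hG; case: (leqP k l) => cmp.
  exact: (below_extremal_or_iso_le nc deg cL jLW bigW (ltnW hk) cmp).
exact: (below_extremal_or_iso_gt nc deg cL jLW bigW cmp).
Qed.
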